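(* Let $T$ be a theory of quantum systems composed by the tensor product with unrestricted states (all density matrices are states), so that its effect set $\mathcal E$ satisfies $\mathcal E\subseteq[0,\mathbb I]$ on every system, with complex conjugation as symmetry. If $\mathcal E$ satisfies (SC$'$), then $\mathcal E\subseteq\mathcal E_{\max}$, where $\mathcal E_{\max}=\{E \text{ Hermitian}: 0\le\Gamma_S(E)\le\mathbb I\ \text{for every subset } S \text{ of the wires}\}$. If $\mathcal E$ satisfies (SC$'$) and is in addition convex and closed, then $\mathcal E$ is sectorially closed, i.e. $\Gamma_S(\mathcal E)\subseteq\mathcal E$ for every system and every subset $S$ of its wires.
   Context: A wire carries a finite-dimensional complex Hilbert space with a fixed orthonormal basis; a system is a finite list of wires composed by the tensor product. $\Gamma_S$ is partial transposition in the fixed bases on the wires in $S$. The theory assigns to every system an effect set $\mathcal E$ of Hermitian operators, containing $0$ and $\mathbb I$, closed under $E\mapsto\mathbb I-E$, and invariant under the global transpose (complex conjugation being a symmetry of the theory). $[0,\mathbb I]=\{E:0\le E\le\mathbb I\}$. A POVM in $\mathcal E$ is a finite family of elements of $\mathcal E$ summing to $\mathbb I$. **(SC$'$).** The effect set satisfies (SC$'$) if, for every system (the wires held by a party) and every bipartition of its wires into $S$ and its complement (every subset $S$ being allowed), every POVM $\{E_b\}$ in $\mathcal E$ admits POVMs $\{M^{(b)}\}$ and $\{N^{(b)}\}$, again in $\mathcal E$ and with the same index set, such that $$E_b=\tfrac12\bigl(M^{(b)}+\Gamma_S(N^{(b)})\bigr)\quad\text{for each } b .$$ *)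

(* Defs.v *)
From HB Require Import structures.
From mathcomp Require Import all_boot all_order all_algebra.
From mathcomp Require Import sesquilinear spectral complex.
From mathcomp Require Import all_classical all_reals topology normedtype convex.

Set Implicit Arguments.
Unset Strict Implicit.
Unset Printing Implicit Defensive.

Import Order.TTheory GRing.Theory Num.Theory.
Import numFieldNormedType.Exports.

Local Open Scope classical_set_scope.
Local Open Scope sesquilinear_scope.
Local Open Scope ring_scope.

Definition Cplx (R : realType) : numClosedFieldType := complex R.

Section Positivity.
Variables (C : numClosedFieldType) (n : nat).
Implicit Types A B : 'M[C]_n.

(* In [C], [0 <= z] means that [z] is real and nonnegative. *)
Definition psd A : Prop :=
  A \is hermsymmx /\ forall v : 'cV[C]_n, 0 <= (v ^t* *m A *m v) 0 0.

Definition loewner_le A B : Prop := psd (B - A).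

Definition unit_interval : set 'M[C]_n :=
  [set A | loewner_le 0 A /\ loewner_le A 1%:M].

Definition density : set 'M[C]_n := [set A | psd A /\ \tr A = 1].

End Positivity.

Section Systems.
Variables (R : realType) (wire : Type) (wdim : wire -> nat).
Implicit Types s : seq wire.

(* The product basis of the tensor product of the spaces carried by the wires
   of [s]: one basis label for each wire. *)
Definition pbasis s : finType :=
  {dffun forall i : 'I_(size s), 'I_(wdim (tnth (in_tuple s) i))}.

Definition hdim s : nat := #|pbasis s|.

Definition blabel s (i : 'I_(hdim s)) : pbasis s := enum_val i.
Definition bindex s (x : pbasis s) : 'I_(hdim s) := enum_rank x.

Definition splice s (S : {set 'I_(size s)}) (x y : pbasis s) : pbasis s :=
  [ffun i => if i \in S then y i else x i].

(* <x| Gamma_S(A) |y> = <x'| A |y'>, where x' and y' are x and y with their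
   labels on the wires in S exchanged. *)
Definition ptrans s (S : {set 'I_(size s)}) (A : 'M[Cplx R]_(hdim s)) :
    'M[Cplx R]_(hdim s) :=
  \matrix_(i < hdim s, j < hdim s)
    A (bindex (splice S (blabel i) (blabel j)))
      (bindex (splice S (blabel j) (blabel i))).

Definition Emax s : set 'M[Cplx R]_(hdim s) :=
  [set E | E \is hermsymmx /\
           forall S : {set 'I_(size s)}, unit_interval (ptrans S E)].

End Systems.

Arguments Emax R {wire} wdim s.

Unset Implicit Arguments.

(* The values of [wire] are the kinds of wires available in the theory; a wire
   [w] carries [C^(wdim w)] with its standard basis. On Hermitian operators,
   the global transpose in [effectsT] is complex conjugation. *)
Record theory (R : realType) := Theory {
  wire : Type;
  wdim : wire -> nat;
  states : forall s : seq wire, set 'M[Cplx R]_(hdim wdim s);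
  effects : forall s : seq wire, set 'M[Cplx R]_(hdim wdim s);
  states_density : forall s, states s `<=` @density (Cplx R) _;
  effects_herm : forall s E, effects s E -> E \is hermsymmx;
  born : forall s rho E,
    states s rho -> effects s E -> 0 <= \tr (rho *m E) <= 1;
  effects0 : forall s, effects s 0;
  effects1 : forall s, effects s 1%:M;
  effectsC : forall s E, effects s E -> effects s (1%:M - E);
  effectsT : forall s E, effects s E -> effects s E^T }.

Set Implicit Arguments.

Arguments wire {R} _.
Arguments wdim {R} _ _.
Arguments states {R} _ _.
Arguments effects {R} _ _.

Section Theories.
Variables (R : realType) (T : theory R).

Definition unrestricted_states : Prop :=
  forall s : seq (wire T), @density (Cplx R) _ `<=` states T s.

Definition povm (s : seq (wire T)) (B : finType)
    (E : B -> 'M[Cplx R]_(hdim (wdim T) s)) : Prop :=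
  (forall b, effects T s (E b)) /\ \sum_b E b = 1%:M.

Definition SC' : Prop :=
  forall (s : seq (wire T)) (S : {set 'I_(size s)}) (B : finType)
         (E : B -> 'M[Cplx R]_(hdim (wdim T) s)),
    povm E ->
    exists M N : B -> 'M[Cplx R]_(hdim (wdim T) s),
      [/\ povm M, povm N &
          forall b, E b = 2^-1 *: (M b + ptrans S (N b))].

Definition convex_effects : Prop :=
  forall s : seq (wire T), convex_set (effects T s).

Definition closed_effects : Prop :=
  forall s : seq (wire T), closed (effects T s).

Definition sectorially_closed : Prop :=
  forall (s : seq (wire T)) (S : {set 'I_(size s)}),
    ptrans S @` effects T s `<=` effects T s.

End Theories.

(* Main.v *)
(* Applied to the POVM {E, 1 - E} and transposed back by Gamma = Gamma_S, (SC')
   gives effects M, N with Gamma(E) = (Gamma(M) + N) / 2.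
   - For a fixed vector v, f(E) = <v| Gamma(E) |v> thus satisfies
     f(E) >= f(M) / 2. As f is bounded on effects, m = inf f satisfies
     m >= m / 2, i.e. m >= 0. The bound Gamma(E) <= 1 follows by applying this
     to 1 - E.
   - Iterating the identity on M, Gamma(E) = 2^-k Gamma(M_k) + sum_(i <= k)
     2^-i N_i, so Gamma(E) is the limit of convex combinations of effects. *)
Require Import Defs.
From HB Require Import structures.
From mathcomp Require Import all_boot all_order all_algebra.
From mathcomp Require Import sesquilinear complex.
From mathcomp Require Import all_classical all_reals topology normedtype convex.
From mathcomp Require Import interval_inference ring.

Set Implicit Arguments.
Unset Strict Implicit.
Unset Printing Implicit Defensive.

Import Order.TTheory GRing.Theory Num.Theory.
Import numFieldNormedType.Exports.

Local Open Scope classical_set_scope.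
Local Open Scope sesquilinear_scope.
Local Open Scope ring_scope.

(** A nonnegative complex number is real, so this is the Archimedean property of [R]. It lets a
    factor [2 ^- k] absorb any constant. *)
Lemma cplx_ltr_exp2 (R : realType) (x : Cplx R) :
  0 <= x -> exists k, x < 2 ^+ k.
Proof.
case: x => a b; rewrite /Cplx lecE /= => /andP[/eqP -> a0].
exists (Num.bound a).
have /= : a < 2 ^+ (Num.bound a) by exact: upper_nthrootP.
by rewrite -ltcR rmorphXn /= rmorph_nat.
Qed.

Section Positivity.
Variables (C : numClosedFieldType) (n : nat).
Implicit Types (A B : 'M[C]_n) (v : 'cV[C]_n).

Lemma hermsymE A : (A \is hermsymmx) = (A == A ^t*).
Proof. by rewrite is_hermitianmxE expr0 scale1r. Qed.

Lemma hermsymB A B :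
  A \is hermsymmx -> B \is hermsymmx -> A - B \is hermsymmx.
Proof. by rewrite !hermsymE linearB /= map_mxB => /eqP <- /eqP <-. Qed.

Lemma quadE A v : (v ^t* *m A *m v) 0 0 =
  \sum_j \sum_i (v i 0)^* * A i j * v j 0.
Proof.
rewrite mxE; apply: eq_bigr => j _; rewrite mxE mulr_suml.
by apply: eq_bigr => i _; rewrite !mxE.
Qed.

Lemma quad_real A v : A \is hermsymmx -> (v ^t* *m A *m v) 0 0 \is Num.real.
Proof.
rewrite hermsymE => /eqP hA; apply/CrealP.
(* Conjugation exchanges the two summation indices, as [A] is Hermitian. *)
rewrite !quadE rmorph_sum exchange_big; apply: eq_bigr => i _.
rewrite rmorph_sum; apply: eq_bigr => j _.
by rewrite !rmorphM /= conjCK {2}hA !mxE; ring.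
Qed.

Lemma normr_quad A v : (forall i j, `|A i j| <= 1) ->
  `|(v ^t* *m A *m v) 0 0| <= \sum_j \sum_i `|v i 0| * `|v j 0|.
Proof.
move=> leA1; rewrite quadE (le_trans (ler_norm_sum _ _ _))//.
apply: ler_sum => j _; rewrite (le_trans (ler_norm_sum _ _ _))//.
apply: ler_sum => i _; rewrite !normrM norm_conjC ler_wpM2r// ler_piMr//.
Qed.

Lemma psd_diag A i : psd A -> 0 <= A i i.
Proof.
move=> [_ /(_ (delta_mx i 0))].
rewrite (_ : _ ^t* = delta_mx 0 i); last first.
  by apply/matrixP => a b; rewrite !mxE andbC rmorph_nat.
by rewrite -rowE -colE !mxE.
Qed.

(** Partial transposition only permutes entries, so an entrywise bound survives it, whereas an
    operator bound need not. *)
Lemma unit_interval_normr A i j : unit_interval A -> `|A i j| <= 1.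
Proof.
rewrite /unit_interval /loewner_le /= subr0 => -[A0 A1].
have diag1 k : A k k <= 1.
  by have /= := psd_diag k A1; rewrite !mxE eqxx subr_ge0.
have [hA qA] := A0; have Aji : A j i = (A i j)^*.
  by move: hA; rewrite hermsymE => /eqP {1}->; rewrite !mxE.
(* v = -A_ij e_i + e_j gives |A_ij|^2 A_ii + A_jj >= 2 |A_ij|^2. *)
pose x := A i j; pose v : 'cV[C]_n := - x *: delta_mx i 0 + delta_mx j 0.
have : (v ^t* *m A *m v) 0 0 =
       `|x| ^+ 2 * A i i + A j j - `|x| ^+ 2 *+ 2.
  have -> : v ^t* = - x^* *: delta_mx 0 i + delta_mx 0 j.
    apply/matrixP => a b; rewrite !mxE rmorphD rmorphM rmorphN /=.
    by rewrite !rmorph_nat ![(_ == 0) && _]andbC.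
  rewrite mulmxDl -scalemxAl -!rowE mulmxDr -scalemxAr -!colE !mxE Aji -/x.
  by rewrite normCK; ring.
have := qA v => /[swap] -> le0.
have : 0 <= `|x| ^+ 2 * 1 + 1 - `|x| ^+ 2 *+ 2.
  by apply: (le_trans le0); rewrite lerD2r lerD// ler_wpM2l.
have -> : `|x| ^+ 2 * 1 + 1 - `|x| ^+ 2 *+ 2 = 1 - `|x| ^+ 2 by ring.
rewrite subr_ge0.
by rewrite (@expr_le1 _ 2).
Qed.

Lemma gram_ge0 v : 0 <= (v ^t* *m v) 0 0.
Proof. by rewrite mxE sumr_ge0// => i _; rewrite !mxE mulrC mul_conjC_ge0. Qed.

Lemma gram_eq0 v : ((v ^t* *m v) 0 0 == 0) = (v == 0).
Proof.
apply/eqP/eqP => [|->]; last by rewrite mulmx0 mxE.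
rewrite mxE => /psumr_eq0P v0; apply/matrixP => i k; rewrite ord1 mxE.
apply/eqP; rewrite -mul_conjC_eq0 mulrC.
have := v0 _ i isT; rewrite !mxE => ->// j _.
by rewrite !mxE mulrC mul_conjC_ge0.
Qed.

(** The pure state along [v]: its pairing with [A] under the trace is the Rayleigh quotient of [A]
    at [v]. *)
Lemma density_rank1 v : v != 0 ->
  density (((v ^t* *m v) 0 0)^-1 *: (v *m v ^t*)).
Proof.
move=> v0; have g0 := gram_ge0 v.
have gN0 : (v ^t* *m v) 0 0 != 0 by rewrite gram_eq0.
split; last by rewrite linearZ /= mxtrace_mulC trace_mx11 mulVf.
set g := (v ^t* *m v) 0 0 in g0 gN0 *.
split=> [|w].
  rewrite hermsymE; apply/eqP/matrixP => i j; rewrite !mxE !big_ord1 !mxE.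
  rewrite !rmorphM /= conjCK (geC0_conj (x := g^-1)) ?invr_ge0//.
  by rewrite (mulrC (v i ord0)).
rewrite -scalemxAr -scalemxAl mxE mulr_ge0 ?invr_ge0//.
(* The form factors as the squared modulus of the overlap of [v] and [w]. *)
have -> : w ^t* *m (v *m v ^t*) *m w = (v ^t* *m w) ^t* *m (v ^t* *m w).
  rewrite [(v ^t* *m w)^T]trmx_mul map_mxM /= !mulmxA; congr (_ *m _ *m _ *m _).
  by apply/matrixP => i j; rewrite !mxE conjCK.
by rewrite mxE big_ord1 !mxE mulrC mul_conjC_ge0.
Qed.

Lemma born_unit_interval A : A \is hermsymmx ->
  (forall rho, density rho -> 0 <= \tr (rho *m A) <= 1) -> unit_interval A.
Proof.
move=> hA bornA.
have bounds v : 0 <= (v ^t* *m A *m v) 0 0 <= (v ^t* *m v) 0 0.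
  have [->|v0] := eqVneq v 0; first by rewrite !mulmx0 mxE lexx.
  have g0 : 0 < (v ^t* *m v) 0 0 by rewrite lt_def gram_eq0 v0 gram_ge0.
  have := bornA _ (density_rank1 v0).
  rewrite -scalemxAl linearZ /= -mulmxA mxtrace_mulC trace_mx11.
  by rewrite pmulr_rge0 ?invr_gt0// ler_pdivrMl// mulr1.
have h1 : (1%:M : 'M[C]_n) \is hermsymmx by exact: hermitian1mx_subproof.
split; split.
- by rewrite subr0.
- by move=> v; rewrite subr0; case/andP: (bounds v).
- exact: hermsymB.
- move=> v; rewrite mulmxBr mulmxBl mulmx1 [leRHS]mxE [X in _ + X]mxE subr_ge0.
  by case/andP: (bounds v).
Qed.

End Positivity.

Section PartialTranspose.
Variables (R : realType) (wire : Type) (wdim : wire -> nat) (s : seq wire).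
Variable S : {set 'I_(size s)}.
Implicit Types A B : 'M[Cplx R]_(hdim wdim s).
Local Notation Gamma := (@ptrans R wire wdim s S).

Lemma spliceK (x y : pbasis wdim s) :
  splice S (splice S x y) (splice S y x) = x.
Proof. by apply/ffunP => i; rewrite !ffunE; case: (i \in S). Qed.

(** Exchanging the labels on [S] is an involution on pairs that preserves the diagonal; hence
    [ptrans] fixes the identity. *)
Lemma splice_eq (x y : pbasis wdim s) :
  (splice S x y == splice S y x) = (x == y).
Proof.
apply/eqP/eqP => [e|->//].
by move: (spliceK x y) (spliceK y x); rewrite e => ->.
Qed.

Lemma ptrans_is_linear : linear Gamma.
Proof. by move=> a A B; apply/matrixP => i j; rewrite !mxE. Qed.

HB.instance Definition _ := GRing.isLinear.Build _ _ _ _ Gamma ptrans_is_linear.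

Lemma ptransK : involutive Gamma.
Proof.
move=> A; apply/matrixP => i j.
by rewrite !mxE /blabel /bindex !enum_rankK !spliceK !enum_valK.
Qed.

Lemma ptrans1 : Gamma 1%:M = 1%:M.
Proof.
apply/matrixP => i j.
by rewrite !mxE (inj_eq enum_rank_inj) splice_eq (inj_eq enum_val_inj).
Qed.

Lemma hermsym_ptrans A : A \is hermsymmx -> Gamma A \is hermsymmx.
Proof.
rewrite !hermsymE => /eqP hA; apply/eqP/matrixP => i j.
by rewrite !mxE {1}hA !mxE.
Qed.

End PartialTranspose.

Section Theories.
Variables (R : realType) (T : theory R) (s : seq (wire T)).
Implicit Types E F M N : 'M[Cplx R]_(hdim (wdim T) s).

Lemma effects_unit_interval E :
  unrestricted_states T -> effects T s E -> unit_interval E.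
Proof.
move=> uT eE; apply: born_unit_interval; first exact: effects_herm eE.
by move=> rho /uT srho; apply: born srho eE.
Qed.

Lemma SC'_effects (S : {set 'I_(size s)}) E : SC' T -> effects T s E ->
  exists M N, [/\ effects T s M, effects T s N &
                  ptrans S E = 2^-1 *: (ptrans S M + N)].
Proof.
move=> scT eE; pose P b := if b then E else 1%:M - E.
have povmP : povm P.
  by split=> [[]|]; [|exact: effectsC|rewrite big_bool /= subrKC].
have [M [N [[eM _] [eN _] /(_ true) /= ->]]] := scT s S _ P povmP.
exists (M true), (N true); split=> //.
by rewrite linearZ linearD /= ptransK.
Qed.

Lemma convex_effects_mid M N : convex_effects T ->
  effects T s M -> effects T s N -> effects T s (2^-1 *: (M + N)).
Proof.
move=> cT eM eN.
have -> : 2^-1 *: (M + N) = 2^-1 *: M + (1 - 2^-1) *: N.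
  by rewrite scalerDr; congr (_ + _ *: _); field.
have half_le1 : 2^-1 <= 1 :> Cplx R by rewrite invf_le1 ?ler1n ?ltr0n.
have half_ge0 : 0 <= 2^-1 :> Cplx R by rewrite invr_ge0 ler0n.
exact: set_mem (cT s M N (Itv01 half_ge0 half_le1) (mem_set eM) (mem_set eN)).
Qed.

(** No infimum is formed: a lower bound [- c] valid for all effects at once is halved at each use of
    (SC'), and letting [k] grow leaves 0. *)
Lemma psd_ptrans_effects (S : {set 'I_(size s)}) E :
  unrestricted_states T -> SC' T -> effects T s E -> psd (ptrans S E).
Proof.
move=> uT scT eE; split; first exact/hermsym_ptrans/effects_herm/eE.
move=> v; pose f F := (v ^t* *m ptrans S F *m v) 0 0.
pose c := \sum_j \sum_i `|v i 0| * `|v j 0|.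
have c0 : 0 <= c by do 2!(apply: sumr_ge0 => ? _); exact: mulr_ge0.
have fR F : effects T s F -> f F \is Num.real.
  by move=> eF; apply/quad_real/hermsym_ptrans/effects_herm/eF.
have lb k : forall F, effects T s F -> - (2 ^- k * c) <= f F.
  elim: k => [|k IHk] F eF.
    have : `|f F| <= c.
      apply: normr_quad => i j; rewrite mxE.
      exact/unit_interval_normr/effects_unit_interval.
    by rewrite real_ler_norml ?fR// expr0 invr1 mul1r => /andP[].
  have [M [N [eM eN eq]]] := SC'_effects S scT eF.
  have -> : f F = 2^-1 * (f M + (v ^t* *m N *m v) 0 0).
    by rewrite /f eq -scalemxAr -scalemxAl mulmxDr mulmxDl !mxE.
  rewrite exprS invfM -mulrA -mulrN ler_wpM2l ?invr_ge0 ?ler0n//.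
  rewrite ler_wpDr ?IHk//.
  have [[_]] := effects_unit_interval uT eN.
  by rewrite subr0.
(* If [f E] were negative, any [k] with [2 ^+ k] above [c / - f E] would contradict [lb k]. *)
rewrite -/(f E) real_leNgt ?fR//; apply/negP => fE0.
have fE0' : 0 < - f E by rewrite oppr_gt0.
have [k] := cplx_ltr_exp2 (divr_ge0 c0 (ltW fE0')).
rewrite ltr_pdivrMr// => ltc; have := lb k E eE.
by rewrite lerNl ler_pdivlMl ?exprn_gt0// (lt_geF ltc).
Qed.

(** [F] is the iterated expansion with its last term Gamma(M_k) replaced by M_k itself. This keeps
    the weights summing to 1, so [F] is an effect by convexity, at the cost of an error of weight
    [2 ^- k]. *)
Lemma ptrans_approx (S : {set 'I_(size s)}) E k :
  convex_effects T -> SC' T -> effects T s E ->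
  exists F M N, [/\ effects T s F, effects T s M, effects T s N &
    ptrans S E - F = 2 ^- k *: (ptrans S M - N)].
Proof.
move=> cT scT; elim: k E => [|k IHk] E eE.
  by exists E, E, E; split=> //; rewrite expr0 invr1 scale1r.
have [M [N [eM eN ->]]] := SC'_effects S scT eE.
have [F [M' [N' [eF eM' eN' eq]]]] := IHk _ eM.
exists (2^-1 *: (N + F)), M', N'; split=> //; first exact: convex_effects_mid.
by rewrite -scalerBr addrKA eq scalerA exprS invfM.
Qed.

End Theories.

Theorem theorem25 (R : realType) (T : theory R) :
  unrestricted_states T ->
  SC' T ->
  (forall s : seq (wire T), effects T s `<=` Emax R (wdim T) s) /\
  (convex_effects T -> closed_effects T -> sectorially_closed T).
Proof.
move=> uT scT; split=> [s E eE|cT clT s S _ [E eE <-]].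
  split=> [|S]; first exact: effects_herm eE.
  split; rewrite /loewner_le ?subr0; first exact: psd_ptrans_effects eE.
  (* As Gamma fixes the identity, 1 - Gamma(E) is Gamma of the effect 1 - E. *)
  rewrite -(ptrans1 _ _ S) -linearB.
  by apply: psd_ptrans_effects => //; exact: effectsC.
have /closure_id -> := clT s.
move=> B /nbhs_ballP[e /= e0 sB].
(* The 2 bounds each entry of Gamma(M) - N, since entries of effects have modulus at most 1; [k] is
   chosen so that [2 / 2 ^+ k < e]. *)
have e2 : 0 <= 2 / e by rewrite divr_ge0 ?ler0n ?ltW.
have [k] := cplx_ltr_exp2 e2.
rewrite ltr_pdivrMr// mulrC -ltr_pdivrMr ?exprn_gt0// => lte.
have [F [M [N [eF eM eN eq]]]] := ptrans_approx S k cT scT eE.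
(* Balls of matrices are entrywise, so one entry at a time is estimated. *)
exists F; split=> //; apply: sB; split=> // i j.
rewrite -ball_normE /= (_ : _ - _ = (ptrans S E - F) i j); last by rewrite !mxE.
rewrite eq mxE normrM gtr0_norm ?invr_gt0 ?exprn_gt0//.
rewrite (le_lt_trans _ lte)// [leRHS]mulrC ler_wpM2l ?invr_ge0 ?exprn_ge0//.
rewrite !mxE (le_trans (ler_normB _ _))// -[2]/(1 + 1) lerD//.
  exact/unit_interval_normr/effects_unit_interval.
exact/unit_interval_normr/effects_unit_interval.
Qed.
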